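(* For $\sigma,\mu,\nu,\varepsilon,\varepsilon_1,\varepsilon_2\in\{\pm1\}$ and $\xi,\eta\in\mathbb R^3$ let $$\Phi_{\sigma;\mu,\nu}^{\varepsilon;\varepsilon_1,\varepsilon_2}(\xi,\eta)=-\varepsilon\lambda_\sigma(\xi)+\varepsilon_1\lambda_\mu(\eta)+\varepsilon_2\lambda_\nu(\xi-\eta),$$ and let $m_{\sigma;\mu,\nu}^{\varepsilon;\varepsilon_1,\varepsilon_2}$ be the quadratic symbol given in the context. The quadratic symbol $m_{\sigma;\mu,\nu}^{\varepsilon;\varepsilon_1,\varepsilon_2}$ vanishes identically unless there exists $h\in\{\pm1\}$ such that $$\varepsilon\sigma=\varepsilon_1\mu=\varepsilon_2\nu=h,$$ equivalently $\sigma=h\varepsilon$, $\mu=h\varepsilon_1$, $\nu=h\varepsilon_2$. For every (active) interaction satisfying this condition one has $$m_{\sigma;\mu,\nu}^{\varepsilon;\varepsilon_1,\varepsilon_2}=\Phi_{\sigma;\mu,\nu}^{\varepsilon;\varepsilon_1,\varepsilon_2}\,\widetilde m_{\sigma;\mu,\nu}^{\varepsilon;\varepsilon_1,\varepsilon_2},$$ where $$\widetilde m_{\sigma;\mu,\nu}^{\varepsilon;\varepsilon_1,\varepsilon_2}(\xi,\eta)=-\frac{i\varepsilon\varepsilon_1}{2\langle\xi\rangle}\Bigl(\langle\eta\rangle+\varepsilon_1\varepsilon_2\langle\xi-\eta\rangle+h\varepsilon_1+\varepsilon_1\varepsilon\langle\xi\rangle\Bigr).$$ Consequently, $m/\Phi$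 admits a smooth extension across the entire time-resonant set $\{(\xi,\eta):\Phi(\xi,\eta)=0\}$.
   Context: Here $\langle\xi\rangle=\sqrt{1+|\xi|^2}$ and $\lambda_\sigma(\xi)=\langle\xi\rangle+\sigma$ for $\sigma\in\{\pm1\}$, $\xi\in\mathbb R^3$. Define $$q_{\mu\nu}(\eta,\zeta)=\mu\nu\,\lambda_\mu(\eta)\lambda_\nu(\zeta)-\eta\cdot\zeta ,$$ $$m_{\sigma;\mu,\nu}^{\varepsilon;\varepsilon_1,\varepsilon_2}(\xi,\eta)=-\frac{i}{4\langle\xi\rangle}\Bigl[\sigma(\varepsilon_1\mu+\varepsilon_2\nu)+\varepsilon\bigl(1+\varepsilon_1\varepsilon_2\mu\nu\bigr)\Bigr]q_{\mu\nu}(\eta,\xi-\eta).$$ (This is the bilinear Fourier symbol of the quadratic interaction of the input modes $(\mu,\varepsilon_1)$, $(\nu,\varepsilon_2)$ into the output mode $(\sigma,\varepsilon)$ for the system $\psi_{tt}-\Delta\psi+2S_t=S_t^2-|\nabla S|^2-\psi_t^2+|\nabla\psi|^2$, $S_{tt}-\Delta S-2\psi_t=2\nabla\psi\cdot\nabla S-2\psi_tS_t$ on $\mathbb R^3$, diagonalized into its four half-wave modes with frequencies $\varepsilon\lambda_\sigma$.) *)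

(* Defs.v *)
From HB Require Import structures.
From mathcomp Require Import all_boot all_order all_algebra.
From mathcomp Require Import complex.
From mathcomp Require Import all_classical all_reals all_analysis.

Set Implicit Arguments.
Unset Strict Implicit.
Unset Printing Implicit Defensive.

Import Order.TTheory GRing.Theory Num.Theory.
Import numFieldNormedType.Exports.

Local Open Scope ring_scope.

Section Symbols.
Context {R : realType}.
Implicit Types (s mu nu e h : R) (xi eta zeta : 'rV[R]_3).

Definition is_sign (x : R) : Prop := x = 1 \/ x = -1.

(* The norm the library puts on ['rV[R]_3] is the sup norm, so the Euclidean
   inner product is written out; [bracket xi] is sqrt (1 + |xi|^2) for the
   Euclidean |xi|. *)
Definition dot xi eta : R := \sum_(i < 3) xi 0 i * eta 0 i.

Definition bracket xi : R := Num.sqrt (1 + dot xi xi).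

Definition lambda s xi : R := bracket xi + s.

Definition q mu nu eta zeta : R :=
  mu * nu * lambda mu eta * lambda nu zeta - dot eta zeta.

Definition m s mu nu e e1 e2 xi eta : R[i] :=
  - ('i%C / (4 * bracket xi)%:C%C)
  * ((s * (e1 * mu + e2 * nu) + e * (1 + e1 * e2 * mu * nu))
     * q mu nu eta (xi - eta))%:C%C.

Definition Phi s mu nu e e1 e2 xi eta : R :=
  - e * lambda s xi + e1 * lambda mu eta + e2 * lambda nu (xi - eta).

(* [s], [mu], [nu] enter only through the common value [h] of
   [e * s], [e1 * mu] and [e2 * nu]. *)
Definition mtilde h e e1 e2 xi eta : R[i] :=
  - ('i%C * (e * e1)%:C%C / (2 * bracket xi)%:C%C)
  * (bracket eta + e1 * e2 * bracket (xi - eta) + h * e1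
     + e1 * e * bracket xi)%:C%C.

Definition active h s mu nu e e1 e2 : Prop :=
  [/\ e * s = h, e1 * mu = h & e2 * nu = h].

End Symbols.

Section Smoothness.
Context {R : realType}.

(* On a finite-dimensional [U], [C_class k f] says that [f] is of class C^k:
   C^(k+1) means Fréchet differentiable with all directional derivatives
   of class C^k. *)
Fixpoint C_class {U V : normedModType R} (k : nat) (f : U -> V) : Prop :=
  if k is k'.+1 then
    (forall x, differentiable f x) /\ (forall v, C_class k' ('D_v f))
  else continuous f.

Definition smooth {U V : normedModType R} (f : U -> V) : Prop :=
  forall k, C_class k f.

Definition smooth_complex {U : normedModType R} (f : U -> R[i]) : Prop :=
  smooth (fun x => complex.Re (f x) : R) /\
  smooth (fun x => complex.Im (f x) : R).

End Smoothness.

(* Main.v *)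
Require Import Defs.
From HB Require Import structures.
From mathcomp Require Import all_boot all_order all_algebra.
From mathcomp Require Import complex.
From mathcomp Require Import all_classical all_reals all_analysis.
From mathcomp Require Import ring.

Import Order.TTheory GRing.Theory Num.Theory.
Import numFieldNormedType.Exports.

Local Open Scope ring_scope.

(** With [A = e1 * mu] and [B = e2 * nu], the sign factor of [m] is [s (A + B) + e (1 + A B)]. It is
    zero if [B = -A], and also if [A = B = -(e * s)]; so it survives only when all three products
    equal one [h], where it is [4 e] ([m_inactive]). In that case the null form [q] is half a
    difference of squares, one factor being the phase and the other [mtilde] up to a prefactor
    ([m_factor]); this rests on the polarization identity [bracket_sqrD].

    The smooth extension of [m / Phi] is then [mtilde] itself: it is a linear combination of
    brackets divided by [2 <xi>], and brackets are smooth and positive. The classes C^k are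
    therefore shown stable under sums, products, inverses and square roots ([C_classD], [C_classM],
    [C_classV], [C_class_sqrt]). *)

Section CClass.
Context {R : realType} {U : normedModType R}.
Implicit Types (f g : U -> R) (k : nat).

Lemma C_classS k f : C_class k.+1 f <->
  (forall x, differentiable f x) /\ (forall v, C_class k ('D_v f)).
Proof. by []. Qed.

Lemma C_class_cst k (a : R) : C_class k (fun _ : U => a).
Proof.
elim: k a => [|k IH] a; first exact: cst_continuous.
split=> [x|v]; first exact: differentiable_cst.
rewrite (_ : 'D_v _ = fun=> 0); first exact: IH.
by apply/funext => x; rewrite derive_cst.
Qed.

(** Derivatives of products, inverses and square roots again contain the undifferentiated functions,
    which the inductions below need at one order less. *)
Lemma C_classW k f : C_class k.+1 f -> C_class k f.
Proof.
elim: k f => [|k IH] f /C_classS[df Df]; first by move=> x; exact: differentiable_continuous.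
by split=> // v; apply: IH.
Qed.

Lemma C_class_linear k f : linear f -> continuous f -> C_class k f.
Proof.
(* [f] is bundled as a linear map to be its own differential; its derivative along [v] is then the
   constant [f v]. *)
move=> lf cf; pose fL := GRing.isLinear.Build _ _ _ _ f lf.
pose F : {linear U -> R} := HB.pack f fL.
case: k => [//|k]; split=> [x|v].
  exact: (@linear_differentiable _ _ _ F).
rewrite (_ : 'D_v _ = fun=> f v); first exact: C_class_cst.
apply/funext => x; rewrite -[f]/(F : U -> R) deriveE ?diff_lin//.
exact: linear_differentiable.
Qed.

Lemma C_classD k f g :
  C_class k f -> C_class k g -> C_class k (fun x => f x + g x).
Proof.
elim: k f g => [|k IH] f g.
  by move=> cf cg x; exact: continuousD (cf x) (cg x).
move=> /C_classS[df Df] /C_classS[dg Dg]; split=> [x|v]; first exact: differentiableD (df x) (dg x).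
rewrite (_ : 'D_v _ = fun x => 'D_v f x + 'D_v g x); first by apply: IH.
by apply/funext => x; apply: deriveD; exact: diff_derivable.
Qed.

Lemma C_classM k f g :
  C_class k f -> C_class k g -> C_class k (fun x => f x * g x).
Proof.
elim: k f g => [|k IH] f g.
  by move=> cf cg x; exact: continuousM (cf x) (cg x).
move=> Cf Cg; have /C_classS[df Df] := Cf; have /C_classS[dg Dg] := Cg.
split=> [x|v]; first exact: differentiableM (df x) (dg x).
rewrite (_ : 'D_v _ = fun x => f x * 'D_v g x + g x * 'D_v f x).
  by apply: C_classD; apply: IH => //; exact: C_classW.
by apply/funext => x; apply: deriveM; exact: diff_derivable.
Qed.

Lemma C_classN k f : C_class k f -> C_class k (fun x => - f x).
Proof.
move=> Cf; rewrite (_ : (fun x => - f x) = fun x => -1 * f x).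
  by apply: C_classM => //; exact: C_class_cst.
by apply/funext => x; rewrite mulN1r.
Qed.

(** The derivative [- f^-2 f'] involves [f^-1] only at the lower order, so the induction closes for
    a fixed [f]. *)
Lemma C_classV k f : (forall x, f x != 0) ->
  C_class k f -> C_class k (fun x => (f x)^-1).
Proof.
move=> f0; elim: k => [|k IH].
  by move=> cf x; exact: continuousV (f0 x) (cf x).
move=> Cf; have /C_classS[df Df] := Cf.
split=> [x|v]; first exact: differentiableV (df x) (f0 x).
rewrite (_ : 'D_v _ = fun x => - ((f x)^-1 * (f x)^-1 * 'D_v f x)).
  have /IH CV := C_classW _ _ Cf.
  by apply/C_classN/C_classM => //; exact: C_classM.
apply/funext => x; rewrite deriveV//; last exact: diff_derivable.
by rewrite expr2 invfM scaleNr.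
Qed.

Lemma diff_sqrt_comp f x v : 0 < f x -> differentiable f x ->
  differentiable (fun y => Num.sqrt (f y)) x /\
  'D_v (fun y => Num.sqrt (f y)) x = (2 * Num.sqrt (f x))^-1 * 'D_v f x.
Proof.
move=> f0 df.
have [dsqrt sqrtE] := is_derive1_sqrt f0.
have {}dsqrt : differentiable (@Num.sqrt R) (f x) by exact/derivable1_diffP.
have dc : differentiable (Num.sqrt \o f) x by exact: differentiable_comp.
split=> //.
rewrite -[LHS]/('D_v (Num.sqrt \o f) x) deriveE// diff_comp//= -sqrtE !deriveE//.
(* Writing the increment as a multiple of 1 lets linearity reduce the differential of the square
   root to its value at 1. *)
by rewrite -{1}['d f x v]mulr1 [LHS]linearZ mulrC.
Qed.

Lemma C_class_sqrt k f : (forall x, 0 < f x) ->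
  C_class k f -> C_class k (fun x => Num.sqrt (f x)).
Proof.
move=> f0; elim: k => [|k IH].
  by move=> cf x; apply: continuous_comp (cf x) _; exact: sqrt_continuous.
move=> Cf; have /C_classS[df Df] := Cf.
split=> [x|v]; first by have [] := diff_sqrt_comp f x 0 (f0 x) (df x).
rewrite (_ : 'D_v _ = fun x => (2 * Num.sqrt (f x))^-1 * 'D_v f x); last first.
  by apply/funext => x; have [] := diff_sqrt_comp f x v (f0 x) (df x).
apply: C_classM => //; apply: C_classV => [x|].
  by rewrite mulf_neq0// gt_eqF// sqrtr_gt0.
by apply: C_classM; [exact: C_class_cst|apply/IH/C_classW].
Qed.

End CClass.

Section Bracket.
Context {R : realType}.
Implicit Types (xi eta zeta : 'rV[R]_3).

Lemma dotDl xi eta zeta : dot (xi + eta) zeta = dot xi zeta + dot eta zeta.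
Proof. by rewrite /dot -big_split; apply: eq_bigr => i _; rewrite mxE mulrDl. Qed.

Lemma dotC xi eta : dot xi eta = dot eta xi.
Proof. by apply: eq_bigr => i _; rewrite mulrC. Qed.

Lemma dot_ge0 xi : 0 <= dot xi xi.
Proof. by apply: sumr_ge0 => i _; rewrite -expr2 sqr_ge0. Qed.

Lemma bracket_gt0 xi : 0 < bracket xi.
Proof. by rewrite sqrtr_gt0 ltr_pwDl// dot_ge0. Qed.

Lemma bracket_sqr xi : bracket xi ^+ 2 = 1 + dot xi xi.
Proof. by rewrite sqr_sqrtr// addr_ge0// dot_ge0. Qed.

Lemma bracket_sqrD eta zeta : bracket (eta + zeta) ^+ 2
  = bracket eta ^+ 2 + bracket zeta ^+ 2 - 1 + 2 * dot eta zeta.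
Proof.
rewrite !bracket_sqr dotDl (dotC eta (eta + zeta)) (dotC zeta (eta + zeta)).
rewrite !dotDl (dotC zeta eta).
ring.
Qed.

(** Composition with a general [f] covers [xi], [eta] and [xi - eta] at once. *)
Lemma C_class_bracket k (U : normedModType R) (f : U -> 'rV[R]_3) :
  (forall i, C_class k (fun x => f x 0 i)) -> C_class k (fun x => bracket (f x)).
Proof.
move=> Cf; apply: C_class_sqrt => [x|]; first by rewrite ltr_pwDl// dot_ge0.
apply: C_classD; first exact: C_class_cst.
rewrite /dot; under eq_fun do rewrite !big_ord_recl big_ord0 addr0.
by do !apply: C_classD; apply: C_classM.
Qed.

End Bracket.

Section Symbol.
Context {R : realType}.
Implicit Types (xi eta : 'rV[R]_3).

Lemma is_sign_sqr (x : R) : is_sign x -> x ^+ 2 = 1.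
Proof. by move=> [->|->]; rewrite ?sqrrN expr1n. Qed.

Lemma is_signM (x y : R) : is_sign x -> is_sign y -> is_sign (x * y).
Proof.
by move=> [->|->] hy; rewrite ?mul1r// mulN1r; case: hy => ->; rewrite ?opprK;
  [right|left].
Qed.

Lemma sign_neq_add (x y : R) : is_sign x -> is_sign y -> x <> y -> x + y = 0.
Proof. by move=> [->|->] [->|->]; rewrite ?subrr ?addNr. Qed.

(** Both symbols are purely imaginary, so identities and smoothness reduce to one real function
    each. *)
Lemma imaginaryE (c x : R) : - ('i%C / c%:C%C) * x%:C%C = Complex 0 (- (x / c)).
Proof.
rewrite -fmorphV/= mulNr -mulrA -rmorphM/=; apply/eqP.
by rewrite eq_complex /=; apply/andP; split; apply/eqP; ring.
Qed.

Lemma mE (s mu nu e e1 e2 : R) xi eta :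
  m s mu nu e e1 e2 xi eta = Complex 0
    (- ((s * (e1 * mu + e2 * nu) + e * (1 + e1 * e2 * mu * nu))
        * q mu nu eta (xi - eta) / (4 * bracket xi))).
Proof. exact: imaginaryE. Qed.

Lemma mtildeE (h e e1 e2 : R) xi eta :
  mtilde h e e1 e2 xi eta = Complex 0
    (- (e * e1 * (bracket eta + e1 * e2 * bracket (xi - eta) + h * e1
         + e1 * e * bracket xi) / (2 * bracket xi))).
Proof. by rewrite -imaginaryE /mtilde rmorphM; ring. Qed.

(** A sign is its own inverse. *)
Lemma activeE (h s mu nu e e1 e2 : R) :
  is_sign e -> is_sign e1 -> is_sign e2 ->
  active h s mu nu e e1 e2 <-> [/\ s = h * e, mu = h * e1 & nu = h * e2].
Proof.
move=> /is_sign_sqr he /is_sign_sqr he1 /is_sign_sqr he2.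
split=> [[es e1mu e2nu]|[-> -> ->]]; last by split; ring: he he1 he2.
by split; [rewrite -es|rewrite -e1mu|rewrite -e2nu]; ring: he he1 he2.
Qed.

(* With [P = e1 <eta> + e2 <xi - eta> + h], the phase is [P - e <xi>], the last
   factor of [mtilde] is [e1 (P + e <xi>)], and [P ^ 2 - <xi> ^ 2] is twice the
   null form [q] by polarization of [<xi> ^ 2]. *)
Lemma m_factor (h s mu nu e e1 e2 : R) xi eta :
  is_sign h -> is_sign e -> is_sign e1 -> is_sign e2 ->
  active h s mu nu e e1 e2 ->
  m s mu nu e e1 e2 xi eta
  = (Phi s mu nu e e1 e2 xi eta)%:C%C * mtilde h e e1 e2 xi eta.
Proof.
move=> /is_sign_sqr hh he he1 he2 /(activeE _ _ _ _ _ _ _ he he1 he2)[-> -> ->].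
move: he he1 he2 => /is_sign_sqr he /is_sign_sqr he1 /is_sign_sqr he2.
have := bracket_sqrD eta (xi - eta); rewrite addrC subrK => cE.
rewrite mE mtildeE; apply/eqP.
rewrite eq_complex /= mulr0 !mul0r subr0 eqxx addr0 /=; apply/eqP.
rewrite /Phi /q /lambda.
have c0 : bracket xi != 0 by rewrite gt_eqF// bracket_gt0.
move: cE c0; move: (bracket xi) (bracket eta) (bracket (xi - eta)) (dot _ _).
move=> c a b d cE c0.
(* Polarization eliminates the inner product; a rational identity in three brackets remains, modulo
   the squares of the signs being 1. *)
have -> : d = (c ^+ 2 - a ^+ 2 - b ^+ 2 + 1) / 2 by rewrite cE; field.
by field: hh he he1 he2.
Qed.

Lemma m_inactive (s mu nu e e1 e2 : R) xi eta :
  is_sign s -> is_sign mu -> is_sign nu ->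
  is_sign e -> is_sign e1 -> is_sign e2 ->
  ~ (exists h : R, is_sign h /\ active h s mu nu e e1 e2) ->
  m s mu nu e e1 e2 xi eta = 0.
Proof.
move=> hs hmu hnu he he1 he2 na.
rewrite mE (_ : s * _ + _ = 0) ?mul0r ?oppr0//.
have hA := is_signM _ _ he1 hmu; have hB := is_signM _ _ he2 hnu.
have hC := is_signM _ _ he hs.
have A2 := is_sign_sqr _ hA.
have -> : e1 * e2 * mu * nu = (e1 * mu) * (e2 * nu) by ring.
move: A2; have [AB|AB] := pselect (e1 * mu = e2 * nu).
  (* If [A = B], inactivity forces [A = -(e * s)], and the factor becomes
     [-2 e s^2 + e (1 + e^2 s^2) = 0]. *)
  have /(sign_neq_add _ _ hC hA) : e * s <> e1 * mu.
    by move=> CA; apply: na; exists (e * s); split=> //; split; rewrite // -AB.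
  rewrite -AB.
  move=> /eqP; rewrite addrC addr_eq0 => /eqP->.
  by move=> _; ring: (is_sign_sqr _ he) (is_sign_sqr _ hs).
(* If [A = -B], then [A + B = 0] and [1 + A B = 1 - B^2 = 0]. *)
have /eqP := sign_neq_add _ _ hA hB AB.
rewrite addr_eq0 => /eqP->; rewrite sqrrN => B2.
by rewrite addNr mulr0 add0r mulNr -expr2 B2 subrr mulr0.
Qed.

Lemma smooth_mtilde (h e e1 e2 : R) :
  smooth_complex (fun p : 'rV[R]_3 * 'rV[R]_3 => mtilde h e e1 e2 p.1 p.2).
Proof.
pose W := ('rV[R]_3 * 'rV[R]_3)%type.
have C1 k i : C_class k (fun p : W => p.1 0 i).
  apply: C_class_linear => [a p p'|p]; first by rewrite !mxE.
  apply: (@continuous_comp W _ _ fst (fun M : 'rV[R]_3 => M 0 i)).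
    exact: cvg_fst.
  exact: coord_continuous.
have C2 k i : C_class k (fun p : W => p.2 0 i).
  apply: C_class_linear => [a p p'|p]; first by rewrite !mxE.
  apply: (@continuous_comp W _ _ snd (fun M : 'rV[R]_3 => M 0 i)).
    exact: cvg_snd.
  exact: coord_continuous.
have C3 k i : C_class k (fun p : W => (p.1 - p.2) 0 i).
  under eq_fun do rewrite !mxE.
  by apply: C_classD => //; exact: C_classN.
(* The real part is the constant 0; only the imaginary part needs the closure rules. *)
split=> k; under eq_fun do rewrite mtildeE /=; first exact: C_class_cst.
apply/C_classN/C_classM.
  apply: C_classM; first exact: C_class_cst.
  apply: C_classD; last by apply: C_classM; [exact: C_class_cst|exact: C_class_bracket].
  apply: C_classD; last exact: C_class_cst.
  apply: C_classD; first exact: C_class_bracket.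
  by apply: C_classM; [exact: C_class_cst|exact: C_class_bracket].
apply: C_classV => [p|]; first by rewrite mulf_neq0// gt_eqF// bracket_gt0.
by apply: C_classM; [exact: C_class_cst|exact: C_class_bracket].
Qed.

End Symbol.

Theorem proposition4p1 (R : realType) (s mu nu e e1 e2 : R)
  (hs : is_sign s) (hmu : is_sign mu) (hnu : is_sign nu)
  (he : is_sign e) (he1 : is_sign e1) (he2 : is_sign e2) :
  ((~ exists h : R, is_sign h /\ active h s mu nu e e1 e2) ->
     forall xi eta : 'rV[R]_3, m s mu nu e e1 e2 xi eta = 0)
  /\ (forall h : R, is_sign h ->
        (active h s mu nu e e1 e2
         <-> [/\ s = h * e, mu = h * e1 & nu = h * e2]))
  /\ (forall h : R, is_sign h -> active h s mu nu e e1 e2 ->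
        forall xi eta : 'rV[R]_3,
          m s mu nu e e1 e2 xi eta
          = (Phi s mu nu e e1 e2 xi eta)%:C%C * mtilde h e e1 e2 xi eta)
  /\ (exists F : 'rV[R]_3 * 'rV[R]_3 -> R[i],
        smooth_complex F /\
        forall xi eta : 'rV[R]_3, Phi s mu nu e e1 e2 xi eta != 0 ->
          F (xi, eta) = m s mu nu e e1 e2 xi eta
                        / (Phi s mu nu e e1 e2 xi eta)%:C%C).
Proof.
split=> [na xi eta|]; first exact: m_inactive.
split=> [h _|]; first exact: activeE.
split=> [h hh ha xi eta|]; first exact: m_factor.
have [[h [hh ha]]|na] :=
  pselect (exists h : R, is_sign h /\ active h s mu nu e e1 e2).
  exists (fun p => mtilde h e e1 e2 p.1 p.2); split; first exact: smooth_mtilde.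
  move=> xi eta Phi0; rewrite (m_factor h)// mulrAC divff ?mul1r//.
  by rewrite fmorph_eq0.
(* In the inactive case [m] vanishes identically, so the quotient extends by 0. *)
exists (fun=> 0); split; first by split=> k; exact: C_class_cst.
by move=> xi eta _; rewrite m_inactive// mul0r.
Qed.
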